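(* The function $M(\tau,t):=X^{\mathcal F}_{e^{-\tau}}(t)$ satisfies the differential difference equation $$\frac{\partial M}{\partial\tau}(\tau,t)=\frac34M(\tau,t)-\frac12\left(\frac34-\frac{it}{2}\right)M(\tau,t+2i)-\frac12\left(\frac34+\frac{it}{2}\right)M(\tau,t-2i)\qquad(\tau>0,\ t\in\mathbb{C}).$$
   Context: For $x>0$ let $\omega(x)=\sum_{m=1}^\infty(2\pi^2m^4x^2-3\pi m^2x)e^{-\pi m^2x}$. For $n\ge0$ define $$c_n=2\sqrt2\int_0^\infty\frac{\omega(x)}{(x+1)^{3/2}}\left(\frac{x-1}{x+1}\right)^n\,dx .$$ The polynomials $f_n$ (Meixner--Pollaczek polynomials $P_n^{(3/4)}(x;\pi/2)$) are $$f_n(x)=\frac{(3/2)_n}{n!}\,i^n\,{}_2F_1\left(-n,\tfrac34+ix;\tfrac32;2\right),$$ where $(a)_n=a(a+1)\cdots(a+n-1)$. The function $\Xi(t)=\xi\left(\frac12+it\right)$, with $\xi(s)=\frac12 s(s-1)\pi^{-s/2}\Gamma(s/2)\zeta(s)$, has the expansion $\Xi(t)=\sum_{n=0}^\infty i^nc_nf_n(t/2)$ (with $c_n=0$ for odd $n$). The Poisson flow of $\Xi$ associated with the family $\mathcal F=(f_n)_{n\ge0}$ is $$X_r^{\mathcal F}(t)=\sum_{n=0}^\infty i^nc_nr^nf_n\left(\frac t2\right)\qquad(0<r\le1,\ t\in\mathbb{C}).$$ *)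

(* Defs.v *)
From Stdlib Require Import Reals Factorial.
From Coquelicot Require Import Coquelicot.

Open Scope R_scope.

(* Coquelicot's [Series] is real-valued; a complex series is summed
   componentwise, which is convergence in C = R * R. *)
Definition CSeries (a : nat -> C) : C :=
  (Series (fun n => Re (a n)), Series (fun n => Im (a n))).

Fixpoint poch (a : C) (n : nat) : C :=
  match n with
  | O => 1%C
  | S k => (poch a k * (a + INR k))%C
  end.

Definition hyp2F1 (a b c z : C) : C :=
  CSeries (fun k =>
    (poch a k * poch b k / (poch c k * INR (fact k)) * z ^ k)%C).

(* [Series] starts at index 0, whereas the sum runs over m >= 1. *)
Definition omega (x : R) : R :=
  Series (fun k =>
    let m := INR (S k) in
    (2 * PI ^ 2 * m ^ 4 * x ^ 2 - 3 * PI * m ^ 2 * x) * exp (- PI * m ^ 2 * x)).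

Definition coef (n : nat) : R :=
  2 * sqrt 2 *
  RInt_gen (fun x =>
      omega x / Rpower (x + 1) (3 / 2) * ((x - 1) / (x + 1)) ^ n)
    (at_right 0) (Rbar_locally p_infty).

(* Meixner--Pollaczek polynomials P_n^(3/4)(x; pi/2).  The hypergeometric
   series terminates because [poch (- n) k = 0] for k > n. *)
Definition mpoly (n : nat) (x : C) : C :=
  (poch (3 / 2) n / INR (fact n) * Ci ^ n
   * hyp2F1 (- INR n) (3 / 4 + Ci * x) (3 / 2) 2)%C.

Definition Xi_flow (r : R) (t : C) : C :=
  CSeries (fun n => (Ci ^ n * coef n * r ^ n * mpoly n (t / 2))%C).

Definition M (tau : R) (t : C) : C := Xi_flow (exp (- tau)) t.

(* Main.v *)
Require Import Defs.
From Stdlib Require Import Reals Lra Lia Factorial Classical.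
From Coquelicot Require Import Coquelicot.

(** Put [r = exp (- tau)].  The flow is a power series in [r] whose n-th
    coefficient is [i^n c_n f_n (t / 2)], so differentiating it in [tau]
    multiplies the n-th term by [- n].  The equation therefore holds term by
    term as soon as
      [n f_n (x) = 1/2 (3/4 - ix) f_n (x + i) + 1/2 (3/4 + ix) f_n (x - i)
                   - 3/4 f_n (x)],
    read at [x = t / 2], where [x +- i = (t +- 2i) / 2].

    This difference equation is Gauss's contiguous relation
      [(c - b) F(a, b - 1) + (2a - c) F(a, b) + b F(a, b + 1) = 0]
    at argument 2, with [a = - n] and [b = 3/4 + ix]
    ([contiguous_partial], [mpoly_difference]).

    What remains is to differentiate term by term, for which it is enough that
    the power series has radius of convergence at least 1.
    - Exchanging [a] and [b] in the same contiguous relation gives the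
      three-term recurrence of the [f_n] ([mpoly_recurrence]).  Solved
      for the highest index, its coefficients are at most [2|x| / k] and 1 in
      absolute value, hence
      [|f_n (x)| <= prod_(k <= n) (1 + 2|x| / k)], a bound whose consecutive
      ratios tend to 1 ([mpoly_growth], [CV_disk_growth]).  The explicit
      hypergeometric sum would not give this, because its terms grow
      exponentially and cancel.
    - The [c_n] are bounded.  A telescoping comparison gives
      [|omega x| <= 108 / sqrt x] for all [x > 0] ([omega_bound]), and
      [1 / (sqrt x (x + 1)^(3/2))] has the bounded primitive
      [2 sqrt x / sqrt (x + 1)] ([coef_bound]). *)

Open Scope R_scope.

(** * Complex series, summed componentwise *)

(** Convergence in [C] is componentwise here because [CSeries] sums
    componentwise; [CSeries] alone does not record that the sum converges. *)
Definition has_csum (a : nat -> C) (l : C) : Prop :=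
  is_series (fun n => Re (a n)) (Re l) /\ is_series (fun n => Im (a n)) (Im l).

Lemma has_csum_CSeries a l : has_csum a l -> CSeries a = l.
Proof.
  intros [hr hi]; unfold CSeries.
  rewrite (is_series_unique _ _ hr), (is_series_unique _ _ hi).
  now destruct l.
Qed.

Lemma has_csum_unique a l l' : has_csum a l -> has_csum a l' -> l = l'.
Proof.
  intros h h'.
  now rewrite <- (has_csum_CSeries _ _ h), <- (has_csum_CSeries _ _ h').
Qed.

Lemma has_csum_ext a b l :
  (forall n, a n = b n) -> has_csum a l -> has_csum b l.
Proof.
  intros e [hr hi]; split.
  - apply (is_series_ext (fun n => Re (a n))); [|exact hr].
    intros n; now rewrite e.
  - apply (is_series_ext (fun n => Im (a n))); [|exact hi].
    intros n; now rewrite e.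
Qed.

Lemma has_csum_minus a b l l' :
  has_csum a l -> has_csum b l' ->
  has_csum (fun n => a n - b n)%C (l - l')%C.
Proof.
  intros [hr hi] [hr' hi']; split.
  - exact (is_series_minus _ _ _ _ hr hr').
  - exact (is_series_minus _ _ _ _ hi hi').
Qed.

Lemma has_csum_scal c a l :
  has_csum a l -> has_csum (fun n => c * a n)%C (c * l)%C.
Proof.
  intros [hr hi]; split.
  - exact (is_series_minus _ _ _ _ (is_series_scal (Re c) _ _ hr)
             (is_series_scal (Im c) _ _ hi)).
  - exact (is_series_plus _ _ _ _ (is_series_scal (Re c) _ _ hi)
             (is_series_scal (Im c) _ _ hr)).
Qed.

Lemma sum_n_support (a : nat -> R) N n :
  (forall k, (N < k)%nat -> a k = 0) -> (N <= n)%nat ->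
  sum_n a n = sum_n a N.
Proof.
  intros h; induction 1 as [|n hn IH]; [reflexivity|].
  rewrite sum_Sn, IH, h by lia; apply Rplus_0_r.
Qed.

Lemma Series_support (a : nat -> R) N :
  (forall k, (N < k)%nat -> a k = 0) -> Series a = sum_n a N.
Proof.
  intros h; apply is_series_unique.
  apply (filterlim_ext_loc (fun _ => sum_n a N)).
  - exists N; intros n hn; symmetry; now apply sum_n_support.
  - apply filterlim_const.
Qed.

Lemma CSeries_support (a : nat -> C) N :
  (forall k, (N < k)%nat -> a k = 0%C) -> CSeries a = sum_n a N.
Proof.
  intros h; unfold CSeries.
  rewrite (Series_support (fun n => Re (a n)) N), (Series_support (fun n => Im (a n)) N)
    by (intros k hk; now rewrite h).
  clear h; induction N as [|N IH].
  - rewrite !sum_O; now destruct (a 0%nat).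
  - rewrite !sum_Sn, <- IH; reflexivity.
Qed.

(** * A contiguous relation for the hypergeometric series at argument 2 *)

Lemma INR_S_C n : RtoC (INR (S n)) = (INR n + 1)%C.
Proof. now rewrite S_INR, RtoC_plus. Qed.

Lemma RtoC_neq0 (x : R) : x <> 0 -> RtoC x <> 0%C.
Proof. intros h e; apply h; now injection e. Qed.

Lemma poch_S_l a k : poch a (S k) = (a * poch (a + 1) k)%C.
Proof.
  induction k as [|k IH]; [simpl; ring|].
  change (poch a (S (S k))) with (poch a (S k) * (a + INR (S k)))%C.
  rewrite IH, INR_S_C; simpl poch; ring.
Qed.

Lemma poch_opp_nat n k : (n < k)%nat -> poch (- INR n) k = 0%C.
Proof.
  induction 1 as [|k hk IH]; simpl.
  - ring.
  - rewrite IH; ring.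
Qed.

Lemma poch_neq0 (c : C) k :
  (forall j : nat, (c + INR j)%C <> 0%C) -> poch c k <> 0%C.
Proof.
  intros h; induction k as [|k IH]; simpl.
  - apply RtoC_neq0; lra.
  - now apply Cmult_neq_0.
Qed.

(** The general term of the hypergeometric series at argument 2. *)
Definition hterm (a b c : C) (k : nat) : C :=
  (poch a k * poch b k / (poch c k * INR (fact k)) * 2 ^ k)%C.

Definition hsum (a b c : C) (N : nat) : C := sum_n (hterm a b c) N.

Lemma hsum_S a b c N : hsum a b c (S N) = (hsum a b c N + hterm a b c (S N))%C.
Proof. unfold hsum; now rewrite sum_Sn. Qed.

Lemma hsum_sym a b c N : hsum a b c N = hsum b a c N.
Proof.
  apply sum_n_ext; intros k; unfold hterm; now rewrite (Cmult_comm (poch a k)).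
Qed.

Lemma hyp2F1_opp_nat n b c N :
  (n <= N)%nat -> hyp2F1 (- INR n) b c 2 = hsum (- INR n) b c N.
Proof.
  intros h; apply CSeries_support; intros k hk.
  rewrite poch_opp_nat by lia; unfold Cdiv; ring.
Qed.

(** The relation is proved for partial sums, with a remainder that vanishes as
    soon as [N] has passed the end of a terminating series.  The reason is a
    telescoping one: with [p_k = (b)_k], the factor
    [(c - b) (b - 1)_k + b (b + 1)_k] equals [(c + 2k) p_k - k (c + k - 1) p_(k-1)],
    and the ratio of consecutive coefficients at argument 2 turns the second
    summand into the remainder at [k - 1]. *)
Lemma contiguous_partial (a b c : C) N :
  (forall j : nat, (c + INR j)%C <> 0%C) ->
  ((c - b) * hsum a (b - 1) c N + (2 * a - c) * hsum a b c N
     + b * hsum a (b + 1) c N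
   = 2 * (INR N + a) * hterm a b c N)%C.
Proof.
  intros hc; induction N as [|N IH].
  - unfold hsum; rewrite !sum_O; unfold hterm; simpl; field.
  - rewrite !hsum_S.
    assert (hp := poch_neq0 c N hc).
    assert (hf : RtoC (INR (fact N)) <> 0%C) by apply RtoC_neq0, INR_fact_neq_0.
    assert (hN : (INR N + 1)%C <> 0%C).
    { rewrite <- INR_S_C; apply RtoC_neq0, not_0_INR; lia. }
    specialize (hc N).
    (* The new terms on the left are the increment of the remainder. *)
    assert (step :
      ((c - b) * hterm a (b - 1) c (S N) + (2 * a - c) * hterm a b c (S N)
         + b * hterm a (b + 1) c (S N)
       = 2 * (INR (S N) + a) * hterm a b c (S N)
         - 2 * (INR N + a) * hterm a b c N)%C).
    { unfold hterm.
      rewrite (poch_S_l (b - 1)).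
      replace (b - 1 + 1)%C with b by ring.
      (* [poch (b + 1)] is expressible through [poch b] only together with
         its factor [b], which may vanish. *)
      assert (e : (b * poch (b + 1) (S N)
                   = poch b N * (b + INR N) * (b + INR N + 1))%C).
      { rewrite <- poch_S_l; cbn [poch]; rewrite INR_S_C; ring. }
      replace (b * (poch a (S N) * poch (b + 1) (S N) /
                 (poch c (S N) * INR (fact (S N))) * 2 ^ S N))%C
        with (poch a (S N) * (b * poch (b + 1) (S N)) /
                 (poch c (S N) * INR (fact (S N))) * 2 ^ S N)%C
        by (unfold Cdiv; ring).
      rewrite e, fact_simpl, mult_INR, RtoC_mult, INR_S_C.
      cbn [poch]; rewrite Cpow_S.
      field; auto. }
    transitivity
      (((c - b) * hsum a (b - 1) c N + (2 * a - c) * hsum a b c N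
          + b * hsum a (b + 1) c N)
       + ((c - b) * hterm a (b - 1) c (S N) + (2 * a - c) * hterm a b c (S N)
          + b * hterm a (b + 1) c (S N)))%C; [ring|].
    rewrite IH, step; ring.
Qed.

(** * Meixner--Pollaczek polynomials *)

Lemma Ci_sqr : (Ci * Ci = - (1))%C.
Proof. apply injective_projections; simpl; ring. Qed.

Lemma three_halves_shift_neq0 (j : nat) : (3 / 2 + INR j)%C <> 0%C.
Proof.
  rewrite <- RtoC_div, <- RtoC_plus by lra.
  apply RtoC_neq0; assert (h := pos_INR j); lra.
Qed.

(** The contiguous relation in the second parameter: replacing [x] by [x + i]
    or [x - i] moves [3/4 + ix] by [- 1] or [+ 1].  At [a = - n], [N = n] the
    remainder carries the factor [N + a = 0]. *)
Lemma mpoly_difference n x :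
  (INR n * mpoly n x
   = 1 / 2 * (3 / 4 - Ci * x) * mpoly n (x + Ci)
     + 1 / 2 * (3 / 4 + Ci * x) * mpoly n (x - Ci)
     - 3 / 4 * mpoly n x)%C.
Proof.
  assert (h := contiguous_partial (- INR n) (3 / 4 + Ci * x) (3 / 2) n
                 three_halves_shift_neq0).
  rewrite <- !hyp2F1_opp_nat in h by lia.
  unfold mpoly.
  replace (3 / 4 + Ci * (x + Ci))%C with (3 / 4 + Ci * x - 1)%C by ring [Ci_sqr].
  replace (3 / 4 + Ci * (x - Ci))%C with (3 / 4 + Ci * x + 1)%C by ring [Ci_sqr].
  set (K := (poch (3 / 2) n / INR (fact n) * Ci ^ n)%C).
  set (F1 := hyp2F1 _ (_ - 1) _ _) in *.
  set (F2 := hyp2F1 _ (_ + Ci * x + 1) _ _) in *.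
  set (F := hyp2F1 _ (3 / 4 + Ci * x) _ _) in *.
  replace (2 * (INR n + - INR n) * _)%C with (RtoC 0) in h by ring.
  transitivity (INR n * (K * F)
    + K / 2 * ((3 / 2 - (3 / 4 + Ci * x)) * F1 + (2 * - INR n - 3 / 2) * F
               + (3 / 4 + Ci * x) * F2))%C.
  - rewrite h; ring.
  - field.
Qed.

Lemma mpoly_0 x : mpoly 0 x = 1%C.
Proof.
  unfold mpoly; rewrite (hyp2F1_opp_nat 0 _ _ 0) by lia.
  unfold hsum; rewrite sum_O; unfold hterm; simpl; field.
Qed.

Lemma mpoly_1 x : mpoly 1 x = (2 * x)%C.
Proof.
  unfold mpoly; rewrite (hyp2F1_opp_nat 1 _ _ 1) by lia.
  rewrite hsum_S; unfold hsum; rewrite sum_O; unfold hterm; simpl.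
  transitivity (- (Ci * Ci) * (2 * x))%C; [field | rewrite Ci_sqr; ring].
Qed.

(** The contiguous relation in the first parameter, that is, with the roles of
    [- n - 1] and [3/4 + ix] exchanged. *)
Lemma mpoly_recurrence n x :
  ((INR n + 2) * mpoly (S (S n)) x
   = 2 * x * mpoly (S n) x - (INR n + 3 / 2) * mpoly n x)%C.
Proof.
  assert (h := contiguous_partial (3 / 4 + Ci * x) (- INR (S n)) (3 / 2) (S (S n))
                 three_halves_shift_neq0).
  rewrite !(hsum_sym (3 / 4 + Ci * x)) in h.
  replace (- INR (S n) - 1)%C with (- INR (S (S n)))%C in h
    by (rewrite !INR_S_C; ring).
  replace (- INR (S n) + 1)%C with (- INR n)%C in h
    by (rewrite !INR_S_C; ring).
  rewrite <- !hyp2F1_opp_nat in h by lia.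
  unfold hterm in h; rewrite (poch_opp_nat (S n) (S (S n))) in h by lia.
  match type of h with _ = ?r =>
    replace r with (RtoC 0) in h by (unfold Cdiv; ring) end.
  unfold mpoly.
  set (F := hyp2F1 (- INR n) _ _ _) in *.
  set (F1 := hyp2F1 (- INR (S n)) _ _ _) in *.
  set (F2 := hyp2F1 (- INR (S (S n))) _ _ _) in *.
  assert (hf : RtoC (INR (fact n)) <> 0%C) by apply RtoC_neq0, INR_fact_neq_0.
  assert (h1 : (INR n + 1)%C <> 0%C).
  { rewrite <- INR_S_C; apply RtoC_neq0, not_0_INR; lia. }
  assert (h2 : (INR n + 1 + 1)%C <> 0%C).
  { rewrite <- !INR_S_C; apply RtoC_neq0, not_0_INR; lia. }
  rewrite !fact_simpl, !mult_INR, !RtoC_mult, !Cpow_S, !INR_S_C.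
  cbn [poch]; rewrite INR_S_C.
  rewrite !INR_S_C in h.
  (* The common part of the three normalizing factors. *)
  set (K := (poch (3 / 2) n * (3 / 2 + INR n) * Ci ^ n
             / (INR (fact n) * (INR n + 1)))%C).
  transitivity (- K * ((3 / 2 - - (INR n + 1)) * F2
    + (2 * (3 / 4 + Ci * x) - 3 / 2) * F1 + - (INR n + 1) * F)
    + 2 * Ci * x * K * F1 - (INR n + 1) * K * F)%C.
  - replace ((INR n + 2) * _)%C with
      ((Ci * Ci) * ((3 / 2 + (INR n + 1)) * K * F2))%C
      by (unfold K; field; auto).
    rewrite Ci_sqr; field.
  - rewrite h; unfold K; field; auto.
Qed.

(** * Subexponential growth of the polynomials *)

(** The solution of the first-order recurrence that majorizes the three-term
    recurrence: [prod_(k = 1..n) (1 + X / k)], of order [n ^ X]. *)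
Fixpoint growth (X : R) (n : nat) : R :=
  match n with
  | O => 1
  | S k => growth X k * (1 + X / INR (S k))
  end.

Lemma growth_factor_ge1 X n : 0 <= X -> 1 <= 1 + X / INR (S n).
Proof.
  intros h; assert (hn := lt_0_INR (S n) (Nat.lt_0_succ n)).
  assert (0 <= X / INR (S n)) by (apply Rdiv_le_0_compat; lra); lra.
Qed.

Lemma growth_pos X n : 0 <= X -> 0 < growth X n.
Proof.
  intros h; induction n as [|n IH]; [simpl; lra|].
  assert (hn := growth_factor_ge1 X n h).
  cbn [growth]; apply Rmult_lt_0_compat; lra.
Qed.

(** In [(n + 2) f_(n+2) = 2x f_(n+1) - (n + 3/2) f_n] the last coefficient is
    at most [n + 2] and the majorant is nondecreasing, so both terms may be
    compared with the majorant at [n + 1]. *)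
Lemma mpoly_growth x n : Cmod (mpoly n x) <= growth (2 * Cmod x) n.
Proof.
  set (X := 2 * Cmod x).
  assert (hX : 0 <= X) by (assert (h := Cmod_ge_0 x); unfold X; lra).
  (* Two consecutive indices, as the recurrence is of second order. *)
  enough (h : Cmod (mpoly n x) <= growth X n
              /\ Cmod (mpoly (S n) x) <= growth X (S n)) by apply h.
  induction n as [|n [IH IH1]]; [|split; [exact IH1|]].
  - rewrite mpoly_0, mpoly_1, Cmod_mult, !Cmod_R, !Rabs_pos_eq by lra.
    change (INR 1) with 1; cbn [growth]; unfold X; simpl; lra.
  - assert (hg := growth_pos X n hX).
    assert (hg1 := growth_pos X (S n) hX).
    assert (hf := growth_factor_ge1 X n hX).
    assert (hn := pos_INR n).
    assert (hmono : growth X n <= growth X (S n)) by (cbn [growth]; nra).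
    assert (hrec : (INR n + 2) * Cmod (mpoly (S (S n)) x)
                   <= X * growth X (S n) + (INR n + 3 / 2) * growth X n).
    { rewrite <- (Rabs_pos_eq (INR n + 2)), <- Cmod_R, <- Cmod_mult by lra.
      rewrite RtoC_plus, mpoly_recurrence.
      unfold Cminus; eapply Rle_trans; [apply Cmod_triangle|].
      rewrite Cmod_opp, !Cmod_mult.
      rewrite <- RtoC_div, <- RtoC_plus by lra.
      rewrite !Cmod_R, !Rabs_pos_eq by lra.
      fold X; nra. }
    change (growth X (S (S n)))
      with (growth X (S n) * (1 + X / INR (S (S n)))).
    replace (INR (S (S n))) with (INR n + 2) by (rewrite !S_INR; ring).
    apply Rmult_le_reg_l with (INR n + 2); [lra|].
    replace ((INR n + 2) * (growth X (S n) * (1 + X / (INR n + 2))))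
      with (growth X (S n) * (INR n + 2 + X)) by (field; lra).
    nra.
Qed.

Lemma CV_disk_growth X r : 0 <= X -> Rabs r < 1 -> CV_disk (growth X) r.
Proof.
  intros hX hr.
  apply (CV_disk_DAlembert _ _ 1).
  - intros n; apply Rgt_not_eq, growth_pos, hX.
  - apply (is_lim_seq_ext (fun n => 1 + X * / INR (S n))).
    + intros n; assert (h := growth_pos X n hX).
      assert (h1 := growth_factor_ge1 X n hX).
      cbn [growth].
      replace (growth X n * (1 + X / INR (S n)) / growth X n)
        with (1 + X / INR (S n)) by (field; split; [apply not_0_INR; lia | lra]).
      rewrite Rabs_pos_eq; [reflexivity | lra].
    + replace 1 with (1 + X * 0) at 1 by ring.
      apply (is_lim_seq_plus' _ _ 1 (X * 0)); [apply is_lim_seq_const|].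
      apply (is_lim_seq_scal_l _ X 0).
      apply (is_lim_seq_inv _ p_infty); [|easy].
      apply -> is_lim_seq_incr_1; apply is_lim_seq_INR.
  - right; rewrite Rinv_1; lra.
Qed.

Lemma CV_radius_growth (a : nat -> R) K X :
  0 <= X -> (forall n, Rabs (a n) <= K * growth X n) ->
  Rbar_le 1 (CV_radius a).
Proof.
  intros hX ha.
  assert (hd : forall r, 0 <= r < 1 -> Rbar_le r (CV_radius a)).
  { intros r hr; apply (Lub_Rbar_correct (CV_disk a)).
    apply (@ex_series_le R_AbsRing R_CompleteNormedModule _
             (fun n => K * Rabs (growth X n * r ^ n))).
    - intros n; change (Rabs (Rabs (a n * r ^ n)) <= K * Rabs (growth X n * r ^ n)).
      rewrite Rabs_Rabsolu, !Rabs_mult, (Rabs_pos_eq (growth X n))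
        by (apply Rlt_le, growth_pos, hX).
      rewrite <- Rmult_assoc; apply Rmult_le_compat_r; [apply Rabs_pos | apply ha].
    - apply (ex_series_scal (V := R_NormedModule) K
               (fun n => Rabs (growth X n * r ^ n))).
      apply CV_disk_growth; [exact hX|].
      rewrite Rabs_pos_eq; lra. }
  assert (h0 := hd 0 ltac:(lra)).
  destruct (CV_radius a) as [ρ| |]; simpl in *; try tauto.
  apply Rnot_lt_le; intros hρ.
  specialize (hd ((ρ + 1) / 2) ltac:(lra)); lra.
Qed.

(** * Boundedness of the coefficients *)

(** The bounds on the partial sums alone force the limit superior and the
    limit inferior to be finite and within the bounds; [Series] is the mean of
    the two, so it is bounded too. *)
Lemma Series_telescope_bound (a u : nat -> R) U :
  0 <= u 0%nat -> (forall n, u n <= U) ->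
  (forall n, Rabs (a n) <= u (S n) - u n) -> Rabs (Series a) <= U.
Proof.
  intros h0 hU ha.
  assert (hs : forall n, Rabs (sum_n a n) <= U).
  { intros n; apply Rle_trans with (u (S n)); [|apply hU].
    induction n as [|n IH].
    - rewrite sum_O; specialize (ha 0%nat); lra.
    - rewrite sum_Sn; eapply Rle_trans; [apply Rabs_triang|].
      specialize (ha (S n)); lra. }
  assert (hle : Rbar_le (Lim_seq (sum_n a)) U).
  { rewrite <- Lim_seq_const; apply Lim_seq_le_loc; exists 0%nat; intros n _.
    specialize (hs n); apply Rabs_le_between in hs; lra. }
  assert (hge : Rbar_le (- U) (Lim_seq (sum_n a))).
  { rewrite <- (Lim_seq_const (- U)); apply Lim_seq_le_loc; exists 0%nat; intros n _.
    specialize (hs n); apply Rabs_le_between in hs; lra. }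
  unfold Series; destruct (Lim_seq (sum_n a)) as [l| |]; simpl in *; try tauto.
  now apply Rabs_le.
Qed.

Lemma exp_ge_cube v : 0 <= v -> (1 + v / 3) ^ 3 <= exp v.
Proof.
  intros h.
  replace (exp v) with (exp (v / 3) ^ 3)
    by (simpl; rewrite Rmult_1_r, <- !exp_plus; f_equal; field).
  assert (h1 := exp_ineq1_le (v / 3)).
  apply pow_incr; lra.
Qed.

(** [exp v] dominates the cube [(1 + v / 3) ^ 3], and [54] times that cube
    dominates [(2 v^2 + 3 v) (1 + v)] coefficientwise. *)
Lemma omega_term_bound v :
  0 <= v -> Rabs (2 * v ^ 2 - 3 * v) * exp (- v) <= 54 / (1 + v).
Proof.
  intros h; rewrite exp_Ropp.
  assert (he := exp_ge_cube v h).
  assert (hpos := exp_pos v).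
  apply Rmult_le_reg_r with (exp v * (1 + v)); [nra|].
  replace (_ * (exp v * (1 + v))) with (Rabs (2 * v ^ 2 - 3 * v) * (1 + v))
    by (field; lra).
  replace (_ * (exp v * (1 + v))) with (54 * exp v) by (field; lra).
  assert (ha : Rabs (2 * v ^ 2 - 3 * v) <= 2 * v ^ 2 + 3 * v) by (apply Rabs_le; nra).
  nra.
Qed.

(** With [h = sqrt x] and [v = PI m^2 x >= (m h)^2], the m-th term is at most
    [54 / (1 + v) <= 108 / (1 + m h)^2], which is below
    [108 / ((1 + m h) (1 + (m - 1) h))], i.e. below the increment from [m - 1]
    to [m] of [108 / h * (m h / (1 + m h))].  The latter is at most [108 / h]. *)
Lemma omega_bound x : 0 < x -> Rabs (omega x) <= 108 / sqrt x.
Proof.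
  intros hx; set (h := sqrt x).
  assert (hh : 0 < h) by (apply sqrt_lt_R0, hx).
  assert (hhh : h * h = x) by (apply sqrt_sqrt; lra).
  apply (Series_telescope_bound _
           (fun k => 108 / h * (INR k * h / (1 + INR k * h)))).
  - simpl; rewrite Rmult_0_l, Rplus_0_r; lra.
  - intros n; assert (hn := pos_INR n).
    assert (0 < 108 / h) by (apply Rdiv_lt_0_compat; lra).
    assert (INR n * h / (1 + INR n * h) <= 1) by (apply -> Rdiv_le_1; nra).
    nra.
  - intros n; cbv zeta; assert (hn := pos_INR n).
    set (m := INR (S n)).
    assert (hm : m = INR n + 1) by apply S_INR.
    set (v := PI * m ^ 2 * x).
    replace (2 * PI ^ 2 * m ^ 4 * x ^ 2 - 3 * PI * m ^ 2 * x)
      with (2 * v ^ 2 - 3 * v) by (unfold v; ring).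
    replace (- PI * m ^ 2 * x) with (- v) by (unfold v; ring).
    assert (hmx : 0 <= (m * h) ^ 2 <= v).
    { split; [apply pow2_ge_0|].
      replace v with (PI * (m * h) ^ 2) by (unfold v; rewrite <- hhh; ring).
      assert (hp := PI2_1); assert (hs := pow2_ge_0 (m * h)); nra. }
    rewrite Rabs_mult, (Rabs_pos_eq (exp _)) by (apply Rlt_le, exp_pos).
    eapply Rle_trans; [apply omega_term_bound; lra|].
    set (y := m * h) in *.
    assert (hy : INR n * h = y - h) by (unfold y; rewrite hm; ring).
    assert (hy' : h <= y) by (unfold y; rewrite hm; nra).
    rewrite hy.
    apply Rle_trans with (108 / (1 + y) ^ 2).
    + apply Rmult_le_reg_r with ((1 + v) * (1 + y) ^ 2);
        [apply Rmult_lt_0_compat; [lra | apply pow_lt; lra]|].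
      replace (54 / (1 + v) * _) with (54 * (1 + y) ^ 2) by (field; lra).
      replace (108 / (1 + y) ^ 2 * _) with (108 * (1 + v)) by (field; lra).
      assert (hs := pow2_ge_0 (1 - y)); nra.
    + replace (108 / h * (y / (1 + y)) - 108 / h * ((y - h) / (1 + (y - h))))
        with (108 / ((1 + y) * (1 + (y - h)))) by (field; lra).
      apply Rmult_le_compat_l; [lra|].
      apply Rinv_le_contravar; nra.
Qed.

Lemma Rpower_three_halves x : 0 < x -> Rpower x (3 / 2) = x * sqrt x.
Proof.
  intros h; replace (3 / 2) with (1 + / 2) by field.
  now rewrite Rpower_plus, Rpower_1, Rpower_sqrt.
Qed.

Lemma RInt_majorant a b : 0 < a < b ->
  is_RInt (fun x => 108 / sqrt x / ((x + 1) * sqrt (x + 1))) a b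
    (216 * (sqrt b / sqrt (b + 1)) - 216 * (sqrt a / sqrt (a + 1))).
Proof.
  intros hab.
  apply (is_RInt_derive (fun x => 216 * (sqrt x / sqrt (x + 1)))).
  - intros x hx; rewrite Rmin_left, Rmax_right in hx by lra.
    assert (hs := sqrt_lt_R0 x ltac:(lra)).
    assert (hs1 := sqrt_lt_R0 (x + 1) ltac:(lra)).
    assert (e := sqrt_sqrt x ltac:(lra)).
    assert (e1 := sqrt_sqrt (x + 1) ltac:(lra)).
    auto_derive; [repeat split; lra|].
    rewrite <- e1 at 5.
    set (s := sqrt x) in *; set (w := sqrt (x + 1)) in *.
    replace (_ / (w * w * w)) with (108 * (w * w - s * s) / (s * (w * w * w)))
      by (rewrite e, e1; field; nra).
    field; lra.
  - intros x hx; rewrite Rmin_left, Rmax_right in hx by lra.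
    apply (ex_derive_continuous (V := R_NormedModule)).
    assert (hs := sqrt_lt_R0 x ltac:(lra)).
    assert (hs1 := sqrt_lt_R0 (x + 1) ltac:(lra)).
    auto_derive; repeat split; nra.
Qed.

(** [RInt_gen] is a total function.  For an integral without a limit, the set
    whose supremum defines its value is the whole line, and the real part of
    [p_infty] is 0. *)
Lemma RInt_gen_divergent (f : R -> R) Fa Fb :
  (forall l, ~ is_RInt_gen f Fa Fb l) -> RInt_gen f Fa Fb = 0.
Proof.
  intros h; change (real (Lub_Rbar (fun x => forall l,
    is_RInt_gen f Fa Fb l -> ball (x + 1) (mkposreal _ Rlt_0_1) l)) = 0).
  rewrite (is_lub_Rbar_unique _ p_infty); [reflexivity|].
  split; [now intros x|].
  intros b hb; destruct b as [b| |]; simpl; [|exact I|].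
  - specialize (hb (b + 1)); simpl in hb.
    enough (b + 1 <= b) by lra.
    apply hb; intros l hl; now destruct (h l).
  - apply (hb 0); intros l hl; now destruct (h l).
Qed.

Lemma coef_integrand_bound n x : 0 < x ->
  Rabs (omega x / Rpower (x + 1) (3 / 2) * ((x - 1) / (x + 1)) ^ n)
  <= 108 / sqrt x / ((x + 1) * sqrt (x + 1)).
Proof.
  intros hx; rewrite Rpower_three_halves by lra.
  assert (hs1 := sqrt_lt_R0 (x + 1) ltac:(lra)).
  assert (hw : 0 < (x + 1) * sqrt (x + 1)) by nra.
  rewrite Rabs_mult, Rabs_div, (Rabs_pos_eq (_ * sqrt _)) by lra.
  rewrite <- (Rmult_1_r (108 / _ / _)).
  apply Rmult_le_compat; try apply Rabs_pos.
  - apply Rdiv_le_0_compat; [apply Rabs_pos | exact hw].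
  - apply Rmult_le_compat_r; [apply Rlt_le, Rinv_0_lt_compat, hw|].
    now apply omega_bound.
  - rewrite <- RPow_abs; apply Rle_trans with (1 ^ n); [|rewrite pow1; lra].
    apply pow_incr; split; [apply Rabs_pos|].
    apply Rabs_le; split.
    + apply Rmult_le_reg_r with (x + 1); [lra|].
      unfold Rdiv; rewrite Rmult_assoc, Rinv_l by lra; lra.
    + apply -> Rdiv_le_1; lra.
Qed.

(** In absolute value the integral over a segment is at most [216], the total
    variation of the primitive in [RInt_majorant], and a limit of such integrals
    lies within [1] of one of them.  The only other value the improper integral
    could take is the 0 of [RInt_gen_divergent]. *)
Lemma coef_integral_bound n :
  Rabs (RInt_gen (fun x => omega x / Rpower (x + 1) (3 / 2) * ((x - 1) / (x + 1)) ^ n)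
          (at_right 0) (Rbar_locally p_infty)) <= 217.
Proof.
  set (f := fun x => _).
  destruct (classic (exists l, is_RInt_gen f (at_right 0) (Rbar_locally p_infty) l))
    as [[l hl]|h].
  2: { rewrite RInt_gen_divergent, Rabs_R0; [lra|].
       intros l hl; apply h; now exists l. }
  rewrite (is_RInt_gen_unique f l hl).
  assert (hab : filter_prod (at_right 0) (Rbar_locally p_infty)
                  (fun ab => 0 < fst ab < snd ab)).
  { exists (fun a => 0 < a < 1) (fun b => 1 < b).
    - exists (mkposreal 1 Rlt_0_1); intros a ha ha0; split; [exact ha0|].
      apply Rabs_def2 in ha; unfold minus, plus, opp in ha; simpl in ha; lra.
    - now exists 1.
    - simpl; intros; lra. }
  assert (hl1 := hl (ball l (mkposreal 1 Rlt_0_1)) (locally_ball l _)).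
  destruct (filter_ex _ (filter_and _ _ hab hl1)) as [[a b] [hab' [y [hy hly]]]].
  simpl in hab', hy.
  assert (hly' : Rabs (y - l) < 1) by exact hly.
  assert (hyb : Rabs y <= 216 * (sqrt b / sqrt (b + 1)) - 216 * (sqrt a / sqrt (a + 1))).
  { apply (norm_RInt_le f _ a b y _ ltac:(lra)) with (3 := RInt_majorant a b hab').
    - intros x hx; apply coef_integrand_bound; lra.
    - exact hy. }
  assert (hb : sqrt b / sqrt (b + 1) <= 1).
  { apply -> Rdiv_le_1; [apply sqrt_le_1; lra | apply sqrt_lt_R0; lra]. }
  assert (ha : 0 <= sqrt a / sqrt (a + 1)).
  { apply Rdiv_le_0_compat; [apply sqrt_pos | apply sqrt_lt_R0; lra]. }
  apply Rabs_def2 in hly'; apply Rabs_le_between in hyb; apply Rabs_le; lra.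
Qed.

Lemma coef_bound n : Rabs (coef n) <= 868.
Proof.
  unfold coef; rewrite Rabs_mult.
  assert (h := coef_integral_bound n).
  assert (h2 : sqrt 2 <= 2) by (rewrite <- (sqrt_square 2) at 2 by lra; apply sqrt_le_1; lra).
  assert (h0 := sqrt_pos 2).
  rewrite (Rabs_pos_eq (2 * sqrt 2)) by lra.
  assert (h1 := Rabs_pos (RInt_gen (fun x => omega x / Rpower (x + 1) (3 / 2) * ((x - 1) / (x + 1)) ^ n)
          (at_right 0) (Rbar_locally p_infty))).
  nra.
Qed.

(** * Differentiation of the Poisson flow *)

Lemma is_derive_pair (f g : R -> R) x df dg :
  is_derive f x df -> is_derive g x dg ->
  is_derive (fun s => (f s, g s)) x (df, dg).
Proof.
  intros hf hg.
  apply (filterdiff_comp'_2 f g pair x (fun y => scal y df) (fun y => scal y dg) pair);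
    [exact hf | exact hg |].
  apply (filterdiff_ext_lin _ (fun p => p)); [|now intros []].
  apply (filterdiff_ext (fun p => p)); [now intros []|].
  apply filterdiff_id.
Qed.

(** By the chain rule the derivative is [- r] times the derived power series;
    shifting that series by one index makes the factor [n] appear. *)
Lemma PSeries_exp_derive (a : nat -> R) tau :
  0 < tau -> Rbar_le 1 (CV_radius a) ->
  exists d, is_derive (fun s => PSeries a (exp (- s))) tau d
    /\ is_series (fun n => - INR n * (a n * exp (- tau) ^ n)) d.
Proof.
  intros ht hr; set (r := exp (- tau)).
  assert (h : Rbar_lt (Rabs r) (CV_radius a)).
  { apply Rbar_lt_le_trans with 1; [|exact hr].
    unfold r; rewrite Rabs_pos_eq by (apply Rlt_le, exp_pos).
    rewrite <- exp_0; apply exp_increasing; lra. }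
  exists (- (r * Derive (PSeries a) r)); split.
  - assert (hd : is_derive (fun s => exp (- s)) tau (- r))
      by (unfold r; auto_derive; [exact I | ring]).
    replace (- (r * _)) with (- r * Derive (PSeries a) r) by ring.
    apply (is_derive_comp (PSeries a) (fun s => exp (- s))); [|exact hd].
    rewrite Derive_PSeries by exact h; now apply is_derive_PSeries.
  - apply (is_series_ext (fun n => opp (scal (pow_n r n) (PS_incr_1 (PS_derive a) n)))).
    + intros [|n].
      * simpl; unfold opp, scal, zero; simpl; unfold mult; simpl; ring.
      * rewrite pow_n_pow; unfold PS_derive, PS_incr_1, opp, scal; simpl PS_incr_1.
        change (- (r ^ S n * (INR (S n) * a (S n))) = - INR (S n) * (a (S n) * r ^ S n)).
        ring.
    + apply (is_series_opp (V := R_NormedModule)).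
      apply (is_pseries_incr_1 (V := R_NormedModule) (PS_derive a) r).
      now apply is_pseries_derive.
Qed.

Definition flow_coef (t : C) (n : nat) : C := (Ci ^ n * coef n * mpoly n (t / 2))%C.

Lemma flow_coef_bound t n :
  Cmod (flow_coef t n) <= 868 * growth (2 * Cmod (t / 2)) n.
Proof.
  unfold flow_coef; rewrite !Cmod_mult, Cmod_pow, Cmod_R.
  assert (hi : Cmod Ci = 1)
    by (transitivity (sqrt 1); [unfold Cmod; simpl; f_equal; ring | apply sqrt_1]).
  rewrite hi, pow1, Rmult_1_l.
  apply Rmult_le_compat; [apply Rabs_pos | apply Cmod_ge_0 | apply coef_bound |].
  apply mpoly_growth.
Qed.

Lemma flow_radius t :
  Rbar_le 1 (CV_radius (fun n => Re (flow_coef t n)))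
  /\ Rbar_le 1 (CV_radius (fun n => Im (flow_coef t n))).
Proof.
  assert (hX : 0 <= 2 * Cmod (t / 2)) by (assert (h := Cmod_ge_0 (t / 2)); lra).
  split; apply (CV_radius_growth _ 868 _ hX); intros n;
    (eapply Rle_trans; [|apply flow_coef_bound]).
  - apply Rle_trans with (2 := Rmax_Cmod _), Rmax_l.
  - apply Rle_trans with (2 := Rmax_Cmod _), Rmax_r.
Qed.

Lemma Re_mult_R z (x : R) : Re (z * x)%C = Re z * x.
Proof. destruct z; simpl; ring. Qed.

Lemma Im_mult_R z (x : R) : Im (z * x)%C = Im z * x.
Proof. destruct z; simpl; ring. Qed.

Lemma M_PSeries tau t :
  M tau t = (PSeries (fun n => Re (flow_coef t n)) (exp (- tau)),
             PSeries (fun n => Im (flow_coef t n)) (exp (- tau))).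
Proof.
  unfold M, Xi_flow, CSeries, PSeries.
  f_equal; apply Series_ext; intros n; unfold flow_coef;
    rewrite <- RtoC_pow, <- ?Re_mult_R, <- ?Im_mult_R; f_equal; ring.
Qed.

Lemma has_csum_M tau t : 0 < tau ->
  has_csum (fun n => flow_coef t n * (exp (- tau) ^ n)%R)%C (M tau t).
Proof.
  intros ht; rewrite M_PSeries.
  assert (hr : Rabs (exp (- tau)) < 1).
  { rewrite Rabs_pos_eq by (apply Rlt_le, exp_pos).
    rewrite <- exp_0; apply exp_increasing; lra. }
  destruct (flow_radius t) as [h1 h2]; split.
  - apply (is_series_ext (fun n => Re (flow_coef t n) * exp (- tau) ^ n)).
    + intros n; now rewrite Re_mult_R.
    + apply (proj1 (is_pseries_R _ _ _)).
      apply PSeries_correct, CV_radius_inside.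
      now apply Rbar_lt_le_trans with 1.
  - apply (is_series_ext (fun n => Im (flow_coef t n) * exp (- tau) ^ n)).
    + intros n; now rewrite Im_mult_R.
    + apply (proj1 (is_pseries_R _ _ _)).
      apply PSeries_correct, CV_radius_inside.
      now apply Rbar_lt_le_trans with 1.
Qed.

Lemma M_derive tau t : 0 < tau ->
  exists d : C, is_derive (fun s => M s t) tau d
    /\ has_csum (fun n => - INR n * (flow_coef t n * (exp (- tau) ^ n)%R))%C d.
Proof.
  intros ht; destruct (flow_radius t) as [h1 h2].
  destruct (PSeries_exp_derive _ tau ht h1) as [d1 [hd1 hs1]].
  destruct (PSeries_exp_derive _ tau ht h2) as [d2 [hd2 hs2]].
  exists (d1, d2); split; [|split].
  - apply (is_derive_ext (fun s => (PSeries (fun n => Re (flow_coef t n)) (exp (- s)),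
             PSeries (fun n => Im (flow_coef t n)) (exp (- s))))).
    + intros s; symmetry; apply M_PSeries.
    + now apply is_derive_pair.
  - refine (is_series_ext _ _ _ _ hs1); intros n; simpl; ring.
  - refine (is_series_ext _ _ _ _ hs2); intros n; simpl; ring.
Qed.

Theorem theorem3p7 :
  forall (tau : R) (t : C), (0 < tau)%R ->
    is_derive (fun s : R => M s t) tau
      (3 / 4 * M tau t
       - 1 / 2 * (3 / 4 - Ci * t / 2) * M tau (t + 2 * Ci)
       - 1 / 2 * (3 / 4 + Ci * t / 2) * M tau (t - 2 * Ci))%C.
Proof.
  intros tau t ht.
  destruct (M_derive tau t ht) as [d [hd hs]].
  (* Both sides are sums of convergent series with equal terms. *)
  enough (e : d = (3 / 4 * M tau t
       - 1 / 2 * (3 / 4 - Ci * t / 2) * M tau (t + 2 * Ci)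
       - 1 / 2 * (3 / 4 + Ci * t / 2) * M tau (t - 2 * Ci))%C)
    by (rewrite <- e; exact hd).
  apply (has_csum_unique _ _ _ hs).
  refine (has_csum_ext _ _ _ _
    (has_csum_minus _ _ _ _
      (has_csum_minus _ _ _ _
        (has_csum_scal _ _ _ (has_csum_M tau t ht))
        (has_csum_scal _ _ _ (has_csum_M tau (t + 2 * Ci)%C ht)))
      (has_csum_scal _ _ _ (has_csum_M tau (t - 2 * Ci)%C ht)))).
  intros n; cbv beta; unfold flow_coef.
  assert (h := mpoly_difference n (t / 2)).
  replace ((t + 2 * Ci) / 2)%C with (t / 2 + Ci)%C by field.
  replace ((t - 2 * Ci) / 2)%C with (t / 2 - Ci)%C by field.
  set (q := RtoC (exp (- tau) ^ n)).
  transitivity (- (Ci ^ n * coef n * q) * (INR n * mpoly n (t / 2)))%C; [|ring].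
  rewrite h; field.
Qed.
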